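(* Let $R$ and $S$ be associative rings with identity and let ${}_SP_R$ be an $(S,R)$-bimodule. The following statements are equivalent: (i) ${}_SP_R$ is invertible. (ii) ${}_SP_R$ is projective of rank one.
   Context: Modules are unitary. A bimodule ${}_SP_R$ is invertible if the functor $P\otimes_R-:R\text{-Mod}\to S\text{-Mod}$ (between categories of all left modules) is an equivalence of categories. A bimodule ${}_SP_R$ is faithfully balanced if the natural maps $S\to\mathrm{End}(P_R)$ and $R\to\mathrm{End}({}_SP)$ (given by left, resp. right, multiplication) are isomorphisms. A bimodule ${}_SP_R$ is projective of rank one if it is faithfully balanced and both $P_R$ and ${}_SP$ are finitely generated projective modules. *)

(* Defs.v *)
From HB Require Import structures.
From mathcomp Require Import all_boot all_algebra ring_quotient.
From mathcomp Require Import boolp.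
From mathcomp.multinomials Require Import freeg.

Set Implicit Arguments.
Unset Strict Implicit.
Unset Printing Implicit Defensive.

Import GRing.Theory.
Local Open Scope ring_scope.
Local Open Scope quotient_scope.

Record category := Category {
  obj :> Type;
  hom : obj -> obj -> Type;
  idm : forall X, hom X X;
  compm : forall X Y Z, hom Y Z -> hom X Y -> hom X Z;
  compm1 : forall X Y (f : hom X Y), compm f (idm X) = f;
  comp1m : forall X Y (f : hom X Y), compm (idm Y) f = f;
  compmA : forall X Y Z T (h : hom Z T) (g : hom Y Z) (f : hom X Y),
    compm h (compm g f) = compm (compm h g) f
}.

Record functor (C D : category) := Functor {
  fobj :> C -> D;
  fmap : forall X Y : C, hom X Y -> hom (fobj X) (fobj Y);
  fmap1 : forall X : C, fmap (idm X) = idm (fobj X);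
  fmapM : forall (X Y Z : C) (g : hom Y Z) (f : hom X Y),
    fmap (compm g f) = compm (fmap g) (fmap f)
}.

Definition idF (C : category) : functor C C :=
  @Functor C C id (fun _ _ f => f) (fun _ => erefl) (fun _ _ _ _ _ => erefl).

Section Compose.
Variables (C D E : category) (G : functor D E) (F : functor C D).

Lemma compF1 (X : C) : fmap G (fmap F (idm X)) = idm (G (F X)).
Proof. by rewrite !fmap1. Qed.

Lemma compFM (X Y Z : C) (g : hom Y Z) (f : hom X Y) :
  fmap G (fmap F (compm g f)) =
  compm (fmap G (fmap F g)) (fmap G (fmap F f)).
Proof. by rewrite !fmapM. Qed.

Definition compF : functor C E :=
  @Functor C E (fun X => G (F X)) (fun _ _ f => fmap G (fmap F f)) compF1 compFM.

End Compose.

Definition is_iso (C : category) (X Y : C) (f : hom X Y) : Prop :=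
  exists g : hom Y X, compm g f = idm X /\ compm f g = idm Y.

Definition nat_iso (C D : category) (F G : functor C D) : Prop :=
  exists eta : forall X : C, hom (F X) (G X),
    (forall (X Y : C) (f : hom X Y),
        compm (eta Y) (fmap F f) = compm (fmap G f) (eta X)) /\
    (forall X : C, is_iso (eta X)).

Definition is_equivalence (C D : category) (F : functor C D) : Prop :=
  exists G : functor D C,
    nat_iso (compF G F) (idF C) /\ nat_iso (compF F G) (idF D).

Section Modules.
Variable R : pzRingType.

Lemma linear_ext (U V : lmodType R) (f g : {linear U -> V}) : f =1 g -> f = g.
Proof.
case: f g => [f [[f0] [fZ]]] [g [[g0] [gZ]]] /= /funext e.
by case: _ / e in g0 gZ *; rewrite (Prop_irrelevance f0 g0) (Prop_irrelevance fZ gZ).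
Qed.

Lemma linear_compm1 (U V : lmodType R) (f : {linear U -> V}) :
  (f \o idfun : {linear U -> V}) = f.
Proof. exact: linear_ext. Qed.

Lemma linear_comp1m (U V : lmodType R) (f : {linear U -> V}) :
  (idfun \o f : {linear U -> V}) = f.
Proof. exact: linear_ext. Qed.

Lemma linear_compmA (U V W T : lmodType R)
    (h : {linear W -> T}) (g : {linear V -> W}) (f : {linear U -> V}) :
  (h \o (g \o f : {linear U -> W}) : {linear U -> T}) =
  ((h \o g : {linear V -> T}) \o f : {linear U -> T}).
Proof. exact: linear_ext. Qed.

Definition ModCat : category :=
  @Category (lmodType R) (fun U V => {linear U -> V})
    (fun U => idfun : {linear U -> U})
    (fun U V W g f => g \o f : {linear U -> W})
    linear_compm1 linear_comp1m linear_compmA.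

Definition finitely_generated (M : lmodType R) : Prop :=
  exists (n : nat) (x : 'I_n -> M),
    forall m : M, exists c : 'I_n -> R, m = \sum_(i < n) c i *: x i.

Definition projective (M : lmodType R) : Prop :=
  forall (A B : lmodType R) (g : {linear A -> B}) (f : {linear M -> B}),
    (forall b, exists a, g a = b) -> exists h : {linear M -> A}, g \o h =1 f.

End Modules.

Definition EndRing (R : pzRingType) (M : lmodType R) : Type := {linear M -> M}.

Section EndomorphismRing.
Variables (R : pzRingType) (M : lmodType R).
Local Notation E := (EndRing M).
Implicit Types f g h : E.

HB.instance Definition _ := gen_eqMixin E.
HB.instance Definition _ := gen_choiceMixin E.

Definition end0 : E := \0 : {linear M -> M}.
Definition endN f : E := (\- (f : {linear M -> M})) : {linear M -> M}.
Definition endD f g : E :=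
  ((f : {linear M -> M}) \+ (g : {linear M -> M})) : {linear M -> M}.
Definition end1 : E := idfun : {linear M -> M}.
Definition endM f g : E :=
  ((f : {linear M -> M}) \o (g : {linear M -> M})) : {linear M -> M}.

Lemma endDA : associative endD.
Proof. by move=> f g h; apply: linear_ext => x /=; rewrite addrA. Qed.
Lemma endDC : commutative endD.
Proof. by move=> f g; apply: linear_ext => x /=; rewrite addrC. Qed.
Lemma end0D : left_id end0 endD.
Proof. by move=> f; apply: linear_ext => x /=; rewrite add0r. Qed.
Lemma endND : left_inverse end0 endN endD.
Proof. by move=> f; apply: linear_ext => x /=; rewrite addNr. Qed.
HB.instance Definition _ := GRing.isZmodule.Build E endDA endDC end0D endND.

Lemma endMA : associative endM.
Proof. by move=> f g h; apply: linear_ext. Qed.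
Lemma end1M : left_id end1 endM.
Proof. by move=> f; apply: linear_ext. Qed.
Lemma endM1 : right_id end1 endM.
Proof. by move=> f; apply: linear_ext. Qed.
Lemma endMDl : left_distributive endM endD.
Proof. by move=> f g h; apply: linear_ext. Qed.
Lemma endMDr : right_distributive endM endD.
Proof. by move=> f g h; apply: linear_ext => x /=; rewrite linearD. Qed.
HB.instance Definition _ :=
  GRing.Zmodule_isPzRing.Build E endMA end1M endM1 endMDl endMDr.

End EndomorphismRing.

HB.mixin Record isBimodule (S R : pzRingType) P of GRing.Lmodule S P := {
  rscale : P -> R -> P;
  rscaleA : forall (p : P) (a b : R), rscale (rscale p a) b = rscale p (a * b);
  rscale1 : forall p : P, rscale p 1 = p;
  rscaleDl : forall a : R, {morph rscale^~ a : p q / p + q};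
  rscaleDr : forall p : P, {morph rscale p : a b / a + b};
  scale_rscale : forall (s : S) (p : P) (a : R),
    s *: rscale p a = rscale (s *: p) a
}.

#[short(type="bimodType")]
HB.structure Definition Bimodule (S R : pzRingType) :=
  {P of isBimodule S R P & GRing.Lmodule S P}.

Notation "p *r a" := (rscale p a) (at level 40, left associativity) : ring_scope.

(* A right R-module is a left module over the converse ring R^c; the alias keeps
   this structure apart from the left S-module structure of P. *)
Definition right_module (S R : pzRingType) (P : bimodType S R) : Type := P.

Section RightModule.
Variables (S R : pzRingType) (P : bimodType S R).
Local Notation PR := (right_module P).

HB.instance Definition _ := GRing.Zmodule.on PR.

Definition right_scale (a : R^c) (p : PR) : PR := (p : P) *r (a : R).

Lemma right_scaleA a b p :
  right_scale a (right_scale b p) = right_scale (a * b) p.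
Proof. exact: rscaleA. Qed.
Lemma right_scale1 : left_id 1 right_scale.
Proof. exact: rscale1. Qed.
Lemma right_scaleDr : right_distributive right_scale +%R.
Proof. move=> a; exact: rscaleDl. Qed.
Lemma right_scaleDl p : {morph right_scale^~ p : a b / a + b}.
Proof. exact: (@rscaleDr _ _ P p). Qed.
HB.instance Definition _ := GRing.Zmodule_isLmodule.Build R^c PR
  right_scaleA right_scale1 right_scaleDr right_scaleDl.

End RightModule.

Section NaturalMaps.
Variables (S R : pzRingType) (P : bimodType S R).
Local Notation PR := (right_module P : lmodType R^c).

Definition lmul_fun (s : S) (p : PR) : PR := s *: (p : P).

Lemma lmul_fun_linear s : linear (lmul_fun s).
Proof.
move=> a p q; rewrite /lmul_fun [s *: _]scalerDr; congr (_ + _).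
exact: scale_rscale.
Qed.
HB.instance Definition _ s :=
  GRing.isLinear.Build R^c PR PR _ (lmul_fun s) (lmul_fun_linear s).

Definition lmul (s : S) : EndRing PR := lmul_fun s : {linear PR -> PR}.

Lemma lmul_zmod_morphism : zmod_morphism lmul.
Proof. by move=> s t; apply: linear_ext => p; apply: (@scalerBl S P s t p). Qed.
Lemma lmul_monoid_morphism : monoid_morphism lmul.
Proof.
split=> [|s t]; apply: linear_ext => p; first exact: (@scale1r S P).
exact/esym/(@scalerA S P).
Qed.
HB.instance Definition _ := GRing.isZmodMorphism.Build S (EndRing PR) lmul
  lmul_zmod_morphism.
HB.instance Definition _ := GRing.isMonoidMorphism.Build S (EndRing PR) lmul
  lmul_monoid_morphism.

Definition rmul_fun (a : R) (p : P) : P := p *r a.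

Lemma rmul_fun_linear a : linear (rmul_fun a).
Proof. by move=> s p q; rewrite /rmul_fun rscaleDl scale_rscale. Qed.
HB.instance Definition _ a :=
  GRing.isLinear.Build S P P _ (rmul_fun a) (rmul_fun_linear a).

(* Endomorphisms of the left module act on the side opposite to the scalars,
   hence the converse ring. *)
Definition rmul (a : R) : (EndRing P)^c := rmul_fun a : {linear P -> P}.

Lemma rmul_zmod_morphism : zmod_morphism rmul.
Proof.
move=> a b; apply: linear_ext => p.
exact: (@scalerBl R^c (right_module P) a b p).
Qed.
Lemma rmul_monoid_morphism : monoid_morphism rmul.
Proof.
split=> [|a b]; apply: linear_ext => p; first exact: (@rscale1 S R P).
exact/esym/(@rscaleA S R P).
Qed.
HB.instance Definition _ := GRing.isZmodMorphism.Build R (EndRing P)^c rmul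
  rmul_zmod_morphism.
HB.instance Definition _ := GRing.isMonoidMorphism.Build R (EndRing P)^c rmul
  rmul_monoid_morphism.

End NaturalMaps.

Section Tensor.
Variables (S R : pzRingType) (P : bimodType S R) (M : lmodType R).

Definition free_prod : zmodType := {freeg (P * M)%type / int}.

Definition free_gen (p : P) (m : M) : free_prod := << (p, m) >>.

Inductive tensor_relator : free_prod -> Prop :=
| TensorDl p q m :
    tensor_relator (free_gen (p + q) m - (free_gen p m + free_gen q m))
| TensorDr p m n :
    tensor_relator (free_gen p (m + n) - (free_gen p m + free_gen p n))
| TensorBal p a m :
    tensor_relator (free_gen (p *r a) m - free_gen p (a *: m)).

(* The subgroup generated by the relators. *)
Definition tensor_null : pred free_prod := fun x =>
  `[< forall Z : {pred free_prod}, zmod_closed Z ->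
      (forall y, tensor_relator y -> y \in Z) -> x \in Z >].

Lemma tensor_null_closed : zmod_closed tensor_null.
Proof.
split=> [|x y /asboolP Nx /asboolP Ny]; apply/asboolP => Z Zc Zr.
  by case: Zc.
by case: (Zc) => _; apply; [apply: Nx | apply: Ny].
Qed.
HB.instance Definition _ :=
  GRing.isZmodClosed.Build free_prod tensor_null tensor_null_closed.

Definition tensor_subgroup : zmodClosed free_prod :=
  GRing.ZmodClosed.clone _ tensor_null _.

Local Notation quot := (Quotient.quot tensor_subgroup).

Definition tensor : Type := quot.
HB.instance Definition _ := GRing.Zmodule.on tensor.

Definition tens (p : P) (m : M) : tensor :=
  \pi_quot (free_gen p m).

Lemma tensor_relatorW x : tensor_relator x -> x \in tensor_null.
Proof. by move=> rx; apply/asboolP => Z _; apply. Qed.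

Lemma tensorBE x y : x - y \in tensor_null ->
  \pi_quot x = \pi_quot y.
Proof. by rewrite Quotient.idealrBE => /eqP. Qed.

Lemma tensDl p q m : tens (p + q) m = tens p m + tens q m.
Proof.
rewrite [RHS](esym (raddfD \pi_quot _ _)).
exact/tensorBE/tensor_relatorW/TensorDl.
Qed.

Lemma tensDr p m n : tens p (m + n) = tens p m + tens p n.
Proof.
rewrite [RHS](esym (raddfD \pi_quot _ _)).
exact/tensorBE/tensor_relatorW/TensorDr.
Qed.

Lemma tens_bal p a m : tens (p *r a) m = tens p (a *: m).
Proof. exact/tensorBE/tensor_relatorW/TensorBal. Qed.

Definition balanced (A : zmodType) (b : P -> M -> A) : Prop :=
  [/\ forall m, {morph b^~ m : p q / p + q},
      forall p, {morph b p : m n / m + n} &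
      forall p a m, b (p *r a) m = b p (a *: m)].

Definition free_lift (A : zmodType) (b : P -> M -> A) (x : free_prod) : A :=
  fglift (fun pm => b pm.1 pm.2 : zmodule A) x.

Lemma free_lift_zmod_morphism A b : zmod_morphism (@free_lift A b).
Proof. exact: (@lift_is_additive int _ (zmodule A)). Qed.
HB.instance Definition _ A b := GRing.isZmodMorphism.Build free_prod A
  (@free_lift A b) (free_lift_zmod_morphism b).

Lemma free_liftE (A : zmodType) b p m :
  @free_lift A b (free_gen p m) = b p m.
Proof. by rewrite /free_lift /free_gen liftU scale1r. Qed.

Lemma free_lift_null (A : zmodType) (b : P -> M -> A) x :
  balanced b -> x \in tensor_null -> free_lift b x = 0.
Proof.
case=> bl br bb /asboolP/(_ [pred y | free_lift b y == 0]) /=.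
move=> h; apply/eqP; apply: h.
  split=> [|y z /eqP ey /eqP ez]; apply/eqP; first exact: raddf0.
  by rewrite raddfB /= ey ez subrr.
move=> _ [p q m|p m n|p a m]; apply/eqP; rewrite raddfB ?raddfD /= !free_liftE.
- by rewrite bl -opprD subrr.
- by rewrite br -opprD subrr.
- by rewrite bb subrr.
Qed.

(* Meaningful only for balanced b: see tens_liftE and tens_lift_additive. *)
Definition tens_lift (A : zmodType) (b : P -> M -> A) (t : tensor) : A :=
  free_lift b (repr (t : quot)).

Lemma tens_lift_pi (A : zmodType) (b : P -> M -> A) x : balanced b ->
  tens_lift b (\pi_quot x) = free_lift b x.
Proof.
move=> bb; apply/eqP; rewrite -subr_eq0 -raddfB; apply/eqP.
apply: free_lift_null => //; rewrite Quotient.idealrBE.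
by rewrite reprK.
Qed.

Lemma tens_liftE (A : zmodType) (b : P -> M -> A) p m : balanced b ->
  tens_lift b (tens p m) = b p m.
Proof. by move=> bb; rewrite tens_lift_pi // free_liftE. Qed.

Lemma tens_lift_additive (A : zmodType) (b : P -> M -> A) : balanced b ->
  {morph tens_lift b : t u / t + u}.
Proof.
move=> bb t u.
rewrite -[t](@reprK _ quot).
rewrite -[u](@reprK _ quot).
rewrite [_ + _](esym (raddfD \pi_quot _ _)).
by rewrite !tens_lift_pi // raddfD.
Qed.

Lemma tensor_ext (A : zmodType) (f g : tensor -> A) :
  {morph f : t u / t + u} -> {morph g : t u / t + u} ->
  (forall p m, f (tens p m) = g (tens p m)) -> f =1 g.
Proof.
move=> fD gD fg t.
have f0 : f 0 = 0 by apply: (addrI (f 0)); rewrite -fD !addr0.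
have g0 : g 0 = 0 by apply: (addrI (g 0)); rewrite -gD !addr0.
have fN u : f (- u) = - f u.
  by apply: (addrI (f u)); rewrite -fD !subrr.
have gN u : g (- u) = - g u.
  by apply: (addrI (g u)); rewrite -gD !subrr.
rewrite -[t](@reprK _ quot).
rewrite -[repr _]freeg_sumE.
rewrite (raddf_sum \pi_quot) /=.
rewrite (big_morph f fD f0) (big_morph g gD g0).
apply: eq_bigr => -[p m] _; set c := coeff _ _.
have -> : << c *g (p, m) >> = free_gen p m *~ c.
  by rewrite /free_gen freegU_mulz intz.
have fn u n : f (u *+ n) = f u *+ n.
  by elim: n => [|n IH]; rewrite ?mulr0n // !mulrS fD IH.
have gn u n : g (u *+ n) = g u *+ n.
  by elim: n => [|n IH]; rewrite ?mulr0n // !mulrS gD IH.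
have fz u z : f (u *~ z) = f u *~ z.
  by case: z => n; rewrite ?NegzE ?mulrNz -!pmulrn ?fN fn.
have gz u z : g (u *~ z) = g u *~ z.
  by case: z => n; rewrite ?NegzE ?mulrNz -!pmulrn ?gN gn.
rewrite (raddfMz \pi_quot).
by rewrite fz gz; congr (_ *~ _); apply: fg.
Qed.

Definition tens_scale (s : S) : tensor -> tensor :=
  tens_lift (fun p m => tens (s *: p) m).

Lemma tens_scale_balanced s : balanced (fun p m => tens (s *: p) m).
Proof.
split=> [m p q|p m n|p a m]; first by rewrite scalerDr tensDl.
- by rewrite tensDr.
- by rewrite scale_rscale tens_bal.
Qed.

Lemma tens_scaleE s p m : tens_scale s (tens p m) = tens (s *: p) m.
Proof. exact/tens_liftE/tens_scale_balanced. Qed.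

Lemma tens_scaleDr : right_distributive tens_scale +%R.
Proof. move=> s; exact/tens_lift_additive/tens_scale_balanced. Qed.

Lemma tens_scaleA s t x : tens_scale s (tens_scale t x) = tens_scale (s * t) x.
Proof.
apply: (tensor_ext (f := tens_scale s \o tens_scale t)) x => [x y|x y|p m] /=.
- by rewrite !tens_scaleDr.
- exact: tens_scaleDr.
- by rewrite !tens_scaleE scalerA.
Qed.

Lemma tens_scale1 : left_id 1 tens_scale.
Proof.
apply: (tensor_ext (g := id)) => [x y|x y|p m] //=; first exact: tens_scaleDr.
by rewrite tens_scaleE scale1r.
Qed.

Lemma tens_scaleDl x : {morph tens_scale^~ x : s t / s + t}.
Proof.
move=> s t; move: x.
apply: (tensor_ext (g := fun x => tens_scale s x + tens_scale t x)).
- exact: tens_scaleDr.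
- by move=> x y; rewrite !tens_scaleDr addrACA.
- by move=> p m; rewrite !tens_scaleE scalerDl tensDl.
Qed.
HB.instance Definition _ := GRing.Zmodule_isLmodule.Build S tensor
  tens_scaleA tens_scale1 tens_scaleDr tens_scaleDl.

End Tensor.

Section TensorFunctor.
Variables (S R : pzRingType) (P : bimodType S R).

Section Map.
Variables (M N : lmodType R) (f : {linear M -> N}).

Definition tens_map_fun : tensor P M -> tensor P N :=
  tens_lift (fun p m => tens p (f m)).

Lemma tens_map_balanced : balanced (fun p m => tens p (f m) : tensor P N).
Proof.
split=> [m p q|p m n|p a m]; first by rewrite tensDl.
- by rewrite linearD tensDr.
- by rewrite linearZ tens_bal.
Qed.

Lemma tens_map_funE p m : tens_map_fun (tens p m) = tens p (f m).
Proof. exact/tens_liftE/tens_map_balanced. Qed.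

Lemma tens_map_funD : {morph tens_map_fun : t u / t + u}.
Proof. exact/tens_lift_additive/tens_map_balanced. Qed.

Lemma tens_map_fun_linear : linear tens_map_fun.
Proof.
move=> s t u; rewrite tens_map_funD; congr (_ + _); move: t {u}.
apply: (tensor_ext (f := tens_map_fun \o *:%R s)
                   (g := *:%R s \o tens_map_fun)).
- by move=> t u /=; rewrite scalerDr tens_map_funD.
- by move=> t u /=; rewrite tens_map_funD scalerDr.
- by move=> p m /=; rewrite [s *: _]tens_scaleE !tens_map_funE [RHS]tens_scaleE.
Qed.
HB.instance Definition _ := GRing.isLinear.Build S (tensor P M) (tensor P N) _
  tens_map_fun tens_map_fun_linear.

Definition tens_map : {linear tensor P M -> tensor P N} := tens_map_fun.

Lemma tens_mapE p m : tens_map (tens p m) = tens p (f m).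
Proof. exact: tens_map_funE. Qed.

End Map.

Lemma tens_map1 (M : lmodType R) :
  tens_map (idfun : {linear M -> M}) = (idfun : {linear tensor P M -> _}).
Proof.
apply/linear_ext/tensor_ext => [t u|t u|p m] //; first exact: linearD.
by rewrite tens_mapE.
Qed.

Lemma tens_mapM (M N L : lmodType R) (g : {linear N -> L}) (f : {linear M -> N}) :
  tens_map (g \o f : {linear M -> L}) =
  (tens_map g \o tens_map f : {linear tensor P M -> tensor P L}).
Proof.
apply/linear_ext/tensor_ext => [t u|t u|p m]; try exact: linearD.
by rewrite /= !tens_mapE.
Qed.

Definition tensor_functor : functor (ModCat R) (ModCat S) :=
  @Functor (ModCat R) (ModCat S) (fun M => tensor P M : lmodType S) tens_map
    tens_map1 tens_mapM.

End TensorFunctor.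

Definition invertible (S R : pzRingType) (P : bimodType S R) : Prop :=
  is_equivalence (tensor_functor P).

(* lmul and rmul are ring morphisms by the instances above, so bijectivity is
   what being a ring isomorphism adds. *)
Definition faithfully_balanced (S R : pzRingType) (P : bimodType S R) : Prop :=
  bijective (@lmul S R P) /\ bijective (@rmul S R P).

Definition projective_rank_one (S R : pzRingType) (P : bimodType S R) : Prop :=
  [/\ faithfully_balanced P,
      finitely_generated (right_module P : lmodType R^c) /\
      projective (right_module P : lmodType R^c) &
      finitely_generated (P : lmodType S) /\ projective (P : lmodType S)].

(* Main.v *)
From HB Require Import structures.
From mathcomp Require Import all_boot all_algebra ring_quotient boolp.
From mathcomp.multinomials Require Import freeg.
Require Import Defs.

Set Implicit Arguments.
Unset Strict Implicit.
Unset Printing Implicit Defensive.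

(** Both conditions amount to a surjective Morita context: a map kappa from
    Hom_S(P, S) to Hom_R(P, R) with psi(p) q = p kappa(psi)(q), such that 1 is a
    finite sum of values psi(p) in S and a finite sum of values kappa(psi)(q) in R.
    If P is projective of rank one, kappa comes from R = End(_S P), and the two
    expressions of 1 are the dual bases of P read through faithful balance.
    Given such a context, the expressions of 1 invert the unit and the counit of
    the adjunction between tensoring with P and Hom_S(P, -).
    If P is invertible, full faithfulness at the regular module gives
    R = End(_S P), hence kappa; writing the preimage of 1 under an isomorphism of
    some P (x) M with S as a sum of pure tensors gives the first expression of 1,
    which implies P T = P for the trace ideal T of R spanned by the values
    kappa(psi)(q); so P (x) R/T = 0, and R = T by faithfulness. *)

Import GRing.Theory.
Local Open Scope ring_scope.
Local Open Scope quotient_scope.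

(** * Natural isomorphisms; equivalences are faithful, full and dense *)

Section Equivalences.
Variables C D : category.

Lemma nat_iso_sym (F G : functor C D) : nat_iso F G -> nat_iso G F.
Proof.
case=> eta [nat_eta iso_eta].
pose inv X := cid (iso_eta X).
exists (fun X => sval (inv X)); split=> [X Y f|X].
  case: (inv X) (inv Y) => [u /= [_ ux]] [v /= [vy _]].
  rewrite -[LHS]compm1 -ux -compmA [compm (fmap G f) _]compmA -nat_eta.
  by rewrite compmA compmA vy comp1m.
by case: (inv X) => u /= [ux xu]; exists (eta X).
Qed.

(** Naturality recovers [f] by conjugating [fmap F f] with the components of the isomorphism. *)
Lemma nat_iso_id_faithful (F : functor C C) (X Y : C) (f g : hom X Y) :
  nat_iso F (idF C) -> fmap F f = fmap F g -> f = g.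
Proof.
case=> eta [nat_eta iso_eta] fg; have [u [_ ux]] := iso_eta X.
rewrite -[f]compm1 -[g]compm1 -ux !compmA; congr compm.
by have := nat_eta _ _ f; have /= <- := nat_eta _ _ g => /= <-; rewrite fg.
Qed.

End Equivalences.

Section EquivalenceProperties.
Variables (C D : category) (F : functor C D).
Hypothesis eqF : is_equivalence F.

Lemma equivalence_faithful (X Y : C) (f g : hom X Y) :
  fmap F f = fmap F g -> f = g.
Proof.
case: eqF => G [GF _] fg; apply: (nat_iso_id_faithful GF).
by rewrite /= fg.
Qed.

(** The preimage is [fmap G h] conjugated by the isomorphism from [compF G F] to the identity. Its
    image is compared with [h] after applying [G], which suffices because [compF F G] is isomorphic
    to the identity. *)
Lemma equivalence_full (X Y : C) (h : hom (F X) (F Y)) :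
  exists f : hom X Y, fmap F f = h.
Proof.
case: eqF => G [[eta [nat_eta iso_eta]] FG].
have [u [ux xu]] := iso_eta X; have [v [vy _]] := iso_eta Y.
exists (compm (eta Y) (compm (fmap G h) u)).
apply: (nat_iso_id_faithful FG) => /=; congr fmap.
set f := compm _ _.
rewrite -[LHS]comp1m -vy -compmA (nat_eta _ _ f) /= /f -!compmA ux.
by rewrite compm1 compmA vy comp1m.
Qed.

Lemma equivalence_dense (Y : D) : exists X (f : hom (F X) Y), is_iso f.
Proof.
case: eqF => G [_ [eta [_ iso_eta]]].
by exists (G Y), (eta Y); apply: iso_eta.
Qed.

End EquivalenceProperties.

Definition mk_linear (R : pzRingType) (U V : lmodType R) (f : U -> V)
    (lf : linear f) : {linear U -> V} :=
  HB.pack f (GRing.isLinear.Build R U V _ f lf).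

Lemma linear_is_iso (R : pzRingType) (U V : lmodType R) (f : {linear U -> V})
    (g : V -> U) : cancel f g -> cancel g f -> @is_iso (ModCat R) U V f.
Proof.
move=> fK gK; exists (mk_linear (can2_linear fK gK)).
by split; apply: linear_ext.
Qed.

Lemma inj_surj_bijective (A B : Type) (f : A -> B) :
  injective f -> (forall b, exists a, f a = b) -> bijective f.
Proof. by move=> injf /choice[g fg]; exists g => // a; apply: injf. Qed.

(** * Dual bases of finitely generated projective modules *)

Section DualBasis.
Variables (R : pzRingType) (M : lmodType R).

Definition dual_basis (s : seq ({linear M -> R^o} * M)) : Prop :=
  forall m, m = \sum_(x <- s) (x.1 m : R) *: x.2.

Lemma dual_basis_fg s : dual_basis s -> finitely_generated M.
Proof.
move=> sP; exists (size s), (fun i => (tnth (in_tuple s) i).2) => m.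
exists (fun i => (tnth (in_tuple s) i).1 m).
by rewrite {1}[m]sP big_tnth.
Qed.

Lemma dual_basis_projective s : dual_basis s -> projective M.
Proof.
move=> sP A B g f /choice[k gk].
(* [k] merely chooses preimages under [g]; the linearity of [h] comes from the coordinates
   [x.1 m]. *)
pose h m := \sum_(x <- s) (x.1 m : R) *: k (f x.2).
have hl : linear h.
  move=> a m n; rewrite /h scaler_sumr -big_split /=; apply: eq_bigr => x _.
  by rewrite linearP scalerDl scalerA.
exists (mk_linear hl) => m /=; rewrite {2}[m]sP /h !linear_sum.
by apply: eq_bigr => x _; rewrite !linearZ /= gk.
Qed.

(** The generators define a surjection from row vectors onto [M]. Projectivity splits it, and the
    coordinates of the splitting are the functionals. *)
Lemma fg_projective_dual_basis :
  finitely_generated M -> projective M -> exists s, dual_basis s.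
Proof.
move=> [n [x xP]] prM.
pose g (v : 'rV[R]_n) := \sum_(i < n) v 0 i *: x i.
have gl : linear g.
  move=> a v w; rewrite /g scaler_sumr -big_split /=; apply: eq_bigr => i _.
  by rewrite !mxE scalerDl scalerA.
have gs m : exists v, mk_linear gl v = m.
  have [c ->] := xP m; exists (\row_i c i); apply: eq_bigr => i _.
  by rewrite mxE.
have [h gh] := prM _ _ (mk_linear gl) (idfun : {linear M -> M}) gs.
have hl i : linear (fun m => h m 0 i : R^o).
  by move=> a m m'; rewrite linearP !mxE.
exists [seq (mk_linear (hl i), x i) | i <- enum 'I_n] => m.
by rewrite big_map big_enum -{1}[m]gh.
Qed.

End DualBasis.

(** * Quotient of a module by a submodule *)

Section QuotientModule.
Variables (R : pzRingType) (V : lmodType R) (W : {pred V}).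
Hypothesis subW : GRing.submod_closed W.

Definition submod_zmodClosed : zmodClosed V :=
  HB.pack W (GRing.isZmodClosed.Build V W (GRing.submod_closedB subW)).
Local Notation quot := (Quotient.quot submod_zmodClosed).

Definition quot_mod : Type := quot.
HB.instance Definition _ := GRing.Zmodule.on quot_mod.

Definition quot_pi (v : V) : quot_mod := \pi_quot v.

Lemma quot_pi_eq v w : (quot_pi v = quot_pi w) <-> (v - w \in W).
Proof.
rewrite -[v - w \in W]/(v - w \in submod_zmodClosed) Quotient.idealrBE.
by split=> /eqP.
Qed.

Lemma quot_piD v w : quot_pi (v + w) = quot_pi v + quot_pi w.
Proof. exact: (raddfD \pi_quot). Qed.

Definition quot_scale (a : R) (x : quot_mod) : quot_mod :=
  quot_pi (a *: repr (x : quot)).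

Lemma quot_piK x : exists v, quot_pi v = x.
Proof. by exists (repr (x : quot)); apply: reprK. Qed.

(** Two representatives differ by an element of [W], which is stable under scaling. *)
Lemma quot_scaleE a v : quot_scale a (quot_pi v) = quot_pi (a *: v).
Proof.
apply/quot_pi_eq; rewrite -scalerBr -[_ *: _]addr0.
by case: subW => W0; apply=> //; apply/quot_pi_eq/reprK.
Qed.

Lemma quot_scaleA a b x : quot_scale a (quot_scale b x) = quot_scale (a * b) x.
Proof. by have [v <-] := quot_piK x; rewrite !quot_scaleE scalerA. Qed.
Lemma quot_scale1 : left_id 1 quot_scale.
Proof. by move=> x; have [v <-] := quot_piK x; rewrite quot_scaleE scale1r. Qed.
Lemma quot_scaleDr : right_distributive quot_scale +%R.
Proof.
move=> a x y; have [v <-] := quot_piK x; have [w <-] := quot_piK y.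
by rewrite -quot_piD !quot_scaleE scalerDr quot_piD.
Qed.
Lemma quot_scaleDl x : {morph quot_scale^~ x : a b / a + b}.
Proof.
move=> a b; have [v <-] := quot_piK x.
by rewrite !quot_scaleE scalerDl quot_piD.
Qed.
HB.instance Definition _ := GRing.Zmodule_isLmodule.Build R quot_mod
  quot_scaleA quot_scale1 quot_scaleDr quot_scaleDl.

Lemma quot_pi_linear : linear quot_pi.
Proof. by move=> a v w; rewrite quot_piD -quot_scaleE. Qed.
HB.instance Definition _ :=
  GRing.isLinear.Build R V quot_mod _ quot_pi quot_pi_linear.

End QuotientModule.

(** * Linear maps on tensor products and sums of pure tensors *)

Section TensorFacts.
Variables (S R : pzRingType) (P : bimodType S R) (M : lmodType R).

Lemma tens_lift_linear (N : lmodType S) (b : P -> M -> N) :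
  balanced b -> (forall s p m, b (s *: p) m = s *: b p m) ->
  linear (tens_lift b).
Proof.
move=> bb bZ s t u; rewrite tens_lift_additive //; congr (_ + _); move: t {u}.
apply: (tensor_ext (f := tens_lift b \o *:%R s) (g := *:%R s \o tens_lift b)).
- by move=> t u /=; rewrite scalerDr tens_lift_additive.
- by move=> t u /=; rewrite tens_lift_additive // scalerDr.
- by move=> p m /=; rewrite [s *: _]tens_scaleE !tens_liftE.
Qed.

Lemma tens_linearl (m : M) : linear (fun p : P => tens p m).
Proof. by move=> s p q; rewrite tensDl -tens_scaleE. Qed.

Lemma tens_suml (I : Type) (r : seq I) (p : I -> P) (m : M) :
  tens (\sum_(i <- r) p i) m = \sum_(i <- r) tens (p i) m.
Proof. exact: (linear_sum (mk_linear (tens_linearl m))). Qed.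

Lemma tens_mulz (p : P) (m : M) (z : int) : tens (p *~ z) m = tens p m *~ z.
Proof. exact: (raddfMz (mk_linear (tens_linearl m))). Qed.

Lemma tens0r (p : P) : tens p (0 : M) = 0.
Proof. by apply: (addrI (tens p (0 : M))); rewrite -tensDr !addr0. Qed.

Lemma tens_sumr (I : Type) (r : seq I) (p : P) (m : I -> M) :
  tens p (\sum_(i <- r) m i) = \sum_(i <- r) tens p (m i).
Proof. exact: (big_morph (tens p) (tensDr p) (tens0r p)). Qed.

(** A tensor is the class of a formal integer combination of pairs; the coefficients are absorbed
    into the left factors. *)
Lemma tensor_sum (t : tensor P M) :
  exists s : seq (P * M), t = \sum_(x <- s) tens x.1 x.2.
Proof.
rewrite -[t](@reprK _ (Quotient.quot (tensor_subgroup P M))).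
move: (repr _) => D; exists [seq (z.1 *~ coeff z D, z.2) | z <- dom D].
rewrite big_map -{1}[D]freeg_sumE (raddf_sum \pi_(Quotient.quot _)) /=.
apply: eq_bigr => -[p m] _ /=; rewrite tens_mulz; set c := coeff _ _.
have -> : << c *g (p, m) >> = free_gen p m *~ c.
  by rewrite /free_gen freegU_mulz intz.
exact: (raddfMz \pi_(Quotient.quot _)).
Qed.

End TensorFacts.

(** * Morita contexts and faithful balance *)

Section Morita.
Variables (S R : pzRingType) (P : bimodType S R).
Local Notation PR := (right_module P : lmodType R^c).
Local Notation ldual := {linear P -> S^o}.
Local Notation rdual := {linear PR -> (R^c)^o}.

Lemma rscale_sumr (I : Type) (r : seq I) (p : P) (a : I -> R) :
  p *r (\sum_(i <- r) a i) = \sum_(i <- r) p *r a i.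
Proof. exact: (scaler_suml (p : PR) r predT (a : I -> R^c)). Qed.

(** Scaling in the regular module of [R^c] is right multiplication in [R]. *)
Lemma rdualM (c : rdual) (p : P) (a : R) : c (p *r a) = (c p : R) * a :> R.
Proof. exact: (linearZ_LR c (a : R^c) (p : PR)). Qed.

(** Associativity of the pairings [psi p] and [kappa psi q], followed by the surjectivity of each,
    stated as an expression of 1. *)
Definition morita_context (kappa : ldual -> rdual) : Prop :=
  [/\ forall (psi : ldual) (p q : P), (psi p : S) *: q = p *r kappa psi q,
      exists s : seq (ldual * P), \sum_(x <- s) x.1 x.2 = 1 :> S &
      exists s : seq (ldual * P), \sum_(x <- s) kappa x.1 x.2 = 1 :> R].

Lemma rmul_bijective_inj : bijective (@rmul S R P) ->
  forall a b : R, (forall p : P, p *r a = p *r b) -> a = b.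
Proof. by move=> /bij_inj inj a b ab; apply: inj; apply: linear_ext. Qed.

Lemma lmul_bijective_inj : bijective (@lmul S R P) ->
  forall s t : S, (forall p : P, s *: p = t *: p) -> s = t.
Proof. by move=> /bij_inj inj s t st; apply: inj; apply: linear_ext. Qed.

(** For fixed [psi] and [q], the map sending [p] to [psi p *: q] is an endomorphism of the left
    module, hence right multiplication by a unique element of [R]. Uniqueness makes that element
    linear in [q]. *)
Lemma rmul_bijective_pairing : bijective (@rmul S R P) ->
  exists kappa : ldual -> rdual,
    forall (psi : ldual) (p q : P), (psi p : S) *: q = p *r kappa psi q.
Proof.
move=> rbij; have inj := rmul_bijective_inj rbij.
suff pair (psi : ldual) : {c : rdual | forall p q : P, (psi p : S) *: q = p *r c q}.
  by exists (fun psi => sval (pair psi)) => psi; case: (pair psi).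
apply: cid.
have hl (q : P) : linear (fun p => (psi p : S) *: q).
  by move=> s p p'; rewrite linearP scalerDl scalerA.
have /choice[c cP] (q : P) : exists a : R, forall p, (psi p : S) *: q = p *r a.
  case: rbij => g _ gK; exists (g (mk_linear (hl q) : EndRing P)) => p.
  exact: (esym (congr1 (fun f : EndRing P => f p) (gK (mk_linear (hl q))))).
have cl : linear (c : PR -> (R^c)^o).
  move=> a q q'; apply: inj => p.
  rewrite -cP scalerDr [LHS](congr1 (+%R^~ _) (scale_rscale _ _ _)) !cP.
  by rewrite rscaleA [RHS](rscaleDr p).
by exists (mk_linear cl).
Qed.

(** Mirror image: for fixed [p], the map sending [q] to [p *r phi q] is an endomorphism of the right
    module, hence left multiplication by a unique element of [S]. *)
Lemma lmul_bijective_pairing (phi : rdual) : bijective (@lmul S R P) ->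
  exists psi : ldual, forall p q : P, (psi p : S) *: q = p *r phi q.
Proof.
move=> lbij; have inj := lmul_bijective_inj lbij.
have hl (p : P) : linear (fun q : PR => p *r phi q : PR).
  move=> a q q'; rewrite linearP [LHS](rscaleDr p); congr (_ + _).
  exact/esym/rscaleA.
have /choice[d dP] (p : P) : exists s : S, forall q : P, s *: q = p *r phi q.
  case: lbij => g _ gK; exists (g (mk_linear (hl p) : EndRing PR)) => q.
  exact: (congr1 (fun f : EndRing PR => f q) (gK (mk_linear (hl p)))).
have dl : linear (d : P -> S^o).
  move=> s p p'; apply: inj => q.
  by rewrite dP rscaleDl -scale_rscale -!dP scalerA -scalerDl.
by exists (mk_linear dl).
Qed.

Lemma rank_one_morita : projective_rank_one P -> exists kappa, morita_context kappa.
Proof.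
case=> -[lbij rbij] [fgR prR] [fgS prS].
have [kappa kP] := rmul_bijective_pairing rbij.
exists kappa; split=> //.
  have [s sP] := fg_projective_dual_basis fgR prR.
  (* [d] turns functionals on the right module into functionals on the left module, the only ones
     that occur in a context. *)
  have /choice[d dP] phi := lmul_bijective_pairing phi lbij.
  exists [seq (d x.1, x.2) | x <- s]; rewrite big_map /=.
  apply: (lmul_bijective_inj lbij) => p; rewrite scale1r [RHS](sP (p : PR)).
  by rewrite scaler_suml; apply: eq_bigr => x _; rewrite dP.
have [s sP] := fg_projective_dual_basis fgS prS.
exists s; apply: (rmul_bijective_inj rbij) => p.
rewrite rscale1 [RHS]sP rscale_sumr.
by apply: eq_bigr => x _; rewrite kP.
Qed.

(** * From a Morita context to rank one *)

Section Context.
Variable kappa : ldual -> rdual.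
Hypothesis kP : forall (psi : ldual) (p q : P), (psi p : S) *: q = p *r kappa psi q.
Variable u : seq (ldual * P).
Hypothesis uP : \sum_(x <- u) x.1 x.2 = 1 :> S.

Lemma right_dual_basis :
  dual_basis [seq (kappa x.1, x.2 : PR) | x <- u].
Proof.
move=> p; rewrite big_map /= -{1}[p](@scale1r S P) -uP scaler_suml.
by apply: eq_bigr => x _; rewrite kP.
Qed.

(** With [u] listing pairs (psi_i, x_i), s = sum psi_i(s x_i) is determined by its action; and h(p)
    = sum h(x_i) kappa(psi_i)(p) = (sum psi_i(h x_i)) p. *)
Lemma trace_lmul_bijective : bijective (@lmul S R P).
Proof.
apply: inj_surj_bijective => [s t st|h].
  rewrite -[s]mulr1 -[t]mulr1 -uP !mulr_sumr; apply: eq_bigr => x _.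
  have e (w : S) : w * x.1 x.2 = x.1 (w *: x.2) by rewrite linearZ.
  by rewrite !e; congr (x.1 _); exact: (congr1 (fun f : EndRing PR => f x.2) st).
exists (\sum_(x <- u) x.1 (h x.2)); apply: linear_ext => p.
rewrite [in RHS](right_dual_basis p) big_map linear_sum /=.
rewrite /lmul_fun scaler_suml; apply: eq_bigr => x _.
by rewrite linearZ kP.
Qed.

Variable v : seq (ldual * P).
Hypothesis vP : \sum_(x <- v) kappa x.1 x.2 = 1 :> R.

Lemma left_dual_basis : dual_basis v.
Proof.
move=> p; rewrite -{1}[p](@rscale1 S R P) -vP rscale_sumr.
by apply: eq_bigr => x _; rewrite kP.
Qed.

(** Symmetrically, a = sum kappa(psi_i)(x_i a), and h(p) = sum psi_i(p) h(x_i) = p (sum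
    kappa(psi_i)(h x_i)). *)
Lemma trace_rmul_bijective : bijective (@rmul S R P).
Proof.
apply: inj_surj_bijective => [a b ab|h].
  rewrite -[a]mul1r -[b]mul1r -vP !mulr_suml; apply: eq_bigr => x _.
  rewrite -!rdualM; congr (kappa x.1 _).
  exact: (congr1 (fun f : EndRing P => f x.2) ab).
exists (\sum_(x <- v) kappa x.1 (h x.2)); apply: linear_ext => p.
rewrite [in RHS](left_dual_basis p) linear_sum /= /rmul_fun rscale_sumr.
by apply: eq_bigr => x _; rewrite linearZ -kP.
Qed.

End Context.

Lemma morita_rank_one kappa : morita_context kappa -> projective_rank_one P.
Proof.
case=> kP [u uP] [v vP]; split.
- split; [exact: trace_lmul_bijective uP | exact: trace_rmul_bijective vP].
- have ub := right_dual_basis kP uP.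
  by split; [exact: dual_basis_fg ub | exact: dual_basis_projective ub].
have vb := left_dual_basis kP vP.
by split; [exact: dual_basis_fg vb | exact: dual_basis_projective vb].
Qed.

End Morita.

(** * The functor Hom_S(P, -), with unit and counit *)

Section HomFunctor.
Variables (S R : pzRingType) (P : bimodType S R).

Definition hom_mod (N : lmodType S) : Type := {linear P -> N}.

Section HomModule.
Variable N : lmodType S.
Local Notation H := (hom_mod N).
Implicit Types f g h : H.

HB.instance Definition _ := gen_eqMixin H.
HB.instance Definition _ := gen_choiceMixin H.

Definition hom_fun (f : H) : {linear P -> N} := f.

Definition hom0 : H := \0 : {linear P -> N}.
Definition homN f : H := (\- (hom_fun f)) : {linear P -> N}.
Definition homD f g : H := (hom_fun f \+ hom_fun g) : {linear P -> N}.
(** The right action on [P] becomes a left action on maps: (a f)(p) = f(p a). *)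
Definition hom_scale (a : R) f : H :=
  (hom_fun f \o rmul_fun a) : {linear P -> N}.

Lemma homDA : associative homD.
Proof. by move=> f g h; apply: linear_ext => x /=; rewrite addrA. Qed.
Lemma homDC : commutative homD.
Proof. by move=> f g; apply: linear_ext => x /=; rewrite addrC. Qed.
Lemma hom0D : left_id hom0 homD.
Proof. by move=> f; apply: linear_ext => x /=; rewrite add0r. Qed.
Lemma homND : left_inverse hom0 homN homD.
Proof. by move=> f; apply: linear_ext => x /=; rewrite addNr. Qed.
HB.instance Definition _ := GRing.isZmodule.Build H homDA homDC hom0D homND.

Lemma hom_scaleA a b f : hom_scale a (hom_scale b f) = hom_scale (a * b) f.
Proof. by apply: linear_ext => p; rewrite /= /rmul_fun rscaleA. Qed.
Lemma hom_scale1 : left_id 1 hom_scale.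
Proof. by move=> f; apply: linear_ext => p; rewrite /= /rmul_fun rscale1. Qed.
Lemma hom_scaleDr : right_distributive hom_scale +%R.
Proof. by move=> a f g; apply: linear_ext. Qed.
Lemma hom_scaleDl f : {morph hom_scale^~ f : a b / a + b}.
Proof.
by move=> a b; apply: linear_ext => p; rewrite /= /rmul_fun rscaleDr linearD.
Qed.
HB.instance Definition _ := GRing.Zmodule_isLmodule.Build R H
  hom_scaleA hom_scale1 hom_scaleDr hom_scaleDl.

End HomModule.

Definition hom_map_fun (N L : lmodType S) (g : {linear N -> L}) (f : hom_mod N) :
  hom_mod L := (g \o hom_fun f) : {linear P -> L}.

Lemma hom_map_linear (N L : lmodType S) (g : {linear N -> L}) :
  linear (hom_map_fun g).
Proof. by move=> a f h; apply: linear_ext => p; rewrite /= linearD. Qed.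

Definition hom_map (N L : lmodType S) (g : {linear N -> L}) :
  {linear hom_mod N -> hom_mod L} := mk_linear (hom_map_linear g).

Lemma hom_map1 (N : lmodType S) :
  hom_map (idfun : {linear N -> N}) = (idfun : {linear hom_mod N -> _}).
Proof. by apply: linear_ext => f; apply: linear_ext. Qed.

Lemma hom_mapM (N L K : lmodType S) (g : {linear L -> K}) (f : {linear N -> L}) :
  hom_map (g \o f : {linear N -> K}) =
  (hom_map g \o hom_map f : {linear hom_mod N -> hom_mod K}).
Proof. by apply: linear_ext => h; apply: linear_ext. Qed.

Definition hom_functor : functor (ModCat S) (ModCat R) :=
  @Functor (ModCat S) (ModCat R) (fun N => hom_mod N : lmodType R) hom_map
    hom_map1 hom_mapM.

(** Compatibility with scalars of [R] is exactly the balancing relation of the tensor product. *)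
Lemma hom_unit_linear (M : lmodType R) :
  linear (fun m : M =>
    (mk_linear (@tens_linearl S R P M m) : hom_mod (tensor P M))).
Proof.
move=> a m n; apply: linear_ext => p /=.
by rewrite tensDr -tens_bal.
Qed.

Definition hom_unit (M : lmodType R) : {linear M -> hom_mod (tensor P M)} :=
  mk_linear (@hom_unit_linear M).

Lemma eval_balanced (N : lmodType S) :
  balanced (fun (p : P) (f : hom_mod N) => hom_fun f p).
Proof. by split=> // f p q; exact: linearD. Qed.

Lemma hom_counit_linear (N : lmodType S) :
  linear (tens_lift (fun (p : P) (f : hom_mod N) => hom_fun f p)).
Proof.
apply: tens_lift_linear; first exact: eval_balanced.
by move=> s p f; rewrite linearZ.
Qed.

Definition hom_counit (N : lmodType S) : {linear tensor P (hom_mod N) -> N} :=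
  mk_linear (@hom_counit_linear N).

Lemma hom_counitE (N : lmodType S) (p : P) (f : hom_mod N) :
  hom_counit N (tens p f) = hom_fun f p.
Proof. exact/tens_liftE/eval_balanced. Qed.

End HomFunctor.

(** * Inverting the unit and the counit from a Morita context *)

Section MoritaEquivalence.
Variables (S R : pzRingType) (P : bimodType S R).
Local Notation PR := (right_module P : lmodType R^c).
Local Notation ldual := {linear P -> S^o}.
Local Notation rdual := {linear PR -> (R^c)^o}.
Variable kappa : ldual -> rdual.
Hypothesis kP : forall (psi : ldual) (p q : P), (psi p : S) *: q = p *r kappa psi q.

Section Unit.
Variable v : seq (ldual * P).
Hypothesis vP : \sum_(x <- v) kappa x.1 x.2 = 1 :> R.
Variable M : lmodType R.

Definition contract (psi : ldual) : tensor P M -> M :=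
  tens_lift (fun p m => (kappa psi p : R) *: m).

Lemma contract_balanced psi :
  balanced (fun (p : P) (m : M) => (kappa psi p : R) *: m).
Proof.
split=> [m p q|p m n|p a m]; last by rewrite rdualM scalerA.
  by rewrite (linearD (kappa psi)) [LHS]scalerDl.
exact: scalerDr.
Qed.

Lemma contractE psi p m : contract psi (tens p m) = (kappa psi p : R) *: m.
Proof. exact/tens_liftE/contract_balanced. Qed.

(** On pure tensors, p (x) kappa(psi)(q) m = p kappa(psi)(q) (x) m = psi(p) q (x) m. *)
Lemma tens_contract (psi : ldual) (p : P) (t : tensor P M) :
  tens p (contract psi t) = (psi p : S) *: t.
Proof.
move: t; apply: tensor_ext => [t u|t u|q m].
- by rewrite /contract tens_lift_additive ?tensDr //; apply: contract_balanced.
- exact: scalerDr.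
by rewrite contractE -tens_bal -kP [RHS]tens_scaleE.
Qed.

Lemma hom_unit_is_iso : @is_iso (ModCat R) M _ (hom_unit P M).
Proof.
(* The two composites are the identity by the expression of 1 in [R] and by the left dual basis that
   it yields. *)
apply: (@linear_is_iso _ _ _ _
  (fun g => \sum_(x <- v) contract x.1 (hom_fun g x.2))) => [m|g].
  under eq_bigr do rewrite /= contractE.
  by rewrite -scaler_suml vP scale1r.
apply: linear_ext => p /=; rewrite tens_sumr.
rewrite [in RHS](left_dual_basis kP vP p) linear_sum.
by apply: eq_bigr => x _; rewrite tens_contract linearZ.
Qed.

End Unit.

Section Counit.
Variable u : seq (ldual * P).
Hypothesis uP : \sum_(x <- u) x.1 x.2 = 1 :> S.
Variable N : lmodType S.

Lemma dual_scale_linear (psi : ldual) (n : N) :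
  linear (fun p => (psi p : S) *: n).
Proof. by move=> s p q; rewrite linearP scalerDl scalerA. Qed.

Definition dual_scale (psi : ldual) (n : N) : hom_mod P N :=
  mk_linear (dual_scale_linear psi n).

(** At q, psi(q) f(p) = f(psi(q) p) = f(q kappa(psi)(p)). *)
Lemma dual_scale_hom (psi : ldual) (f : hom_mod P N) (p : P) :
  dual_scale psi (hom_fun f p) = (kappa psi p : R) *: f.
Proof. by apply: linear_ext => q; rewrite /= -linearZ_LR kP. Qed.

Lemma hom_counit_is_iso : @is_iso (ModCat S) _ N (hom_counit P N).
Proof.
pose g n : tensor P (hom_mod P N) := \sum_(x <- u) tens x.2 (dual_scale x.1 n).
have gD : {morph g : n n' / n + n'}.
  move=> n n'; rewrite /g -big_split; apply: eq_bigr => x _ /=; rewrite -tensDr.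
  by congr tens; apply: linear_ext => p /=; rewrite scalerDr.
apply: (@linear_is_iso _ _ _ _ g) => [|n]; last first.
  rewrite linear_sum -[RHS](@scale1r S) -uP scaler_suml.
  by apply: eq_bigr => x _; rewrite hom_counitE.
apply: (tensor_ext (g := id)) => [t t'|t t'|p f] //; first by rewrite linearD gD.
rewrite hom_counitE /g.
(* The scalar kappa(psi_i)(p) crosses the tensor sign and turns x_i into psi_i(x_i) p; these add up
   to p. *)
under eq_bigr do rewrite dual_scale_hom -tens_bal -kP.
by rewrite -tens_suml -scaler_suml uP scale1r.
Qed.

End Counit.

End MoritaEquivalence.

Lemma morita_invertible (S R : pzRingType) (P : bimodType S R) kappa :
  @morita_context S R P kappa -> invertible P.
Proof.
case=> kP [u uP] [v vP]; exists (hom_functor P); split.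
  (* The unit starts at the identity functor, whereas an equivalence asks for an isomorphism ending
     there. *)
  apply: nat_iso_sym; exists (hom_unit P); split; last first.
    by move=> M; apply: (hom_unit_is_iso kP vP).
  move=> M N f; apply: linear_ext => m; apply: linear_ext => p /=.
  by rewrite tens_map_funE.
exists (hom_counit P); split; last by move=> N; apply: (hom_counit_is_iso kP uP).
move=> M N f; apply/linear_ext/tensor_ext => [t t'|t t'|p g].
- by rewrite linearD.
- by rewrite linearD.
by rewrite /= tens_map_funE [LHS]hom_counitE [X in f X]hom_counitE.
Qed.

(** * The Morita context of an invertible bimodule *)

Section InvertibleContext.
Variables (S R : pzRingType) (P : bimodType S R).
Local Notation PR := (right_module P : lmodType R^c).
Local Notation ldual := {linear P -> S^o}.
Local Notation rdual := {linear PR -> (R^c)^o}.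
Hypothesis invP : invertible P.

Lemma mulr_linear (a : R) : linear (fun b : R^o => b * a : R^o).
Proof. by move=> c x y; rewrite mulrDl -[_ *: _]/(_ * _) -mulrA. Qed.

Lemma act_balanced : balanced (fun (p : P) (a : R^o) => p *r a).
Proof.
split=> [a p q|p a b|p a b]; [exact: rscaleDl | exact: rscaleDr |].
exact: rscaleA.
Qed.

Lemma act_linear : linear (tens_lift (fun (p : P) (a : R^o) => p *r a)).
Proof.
apply: tens_lift_linear; first exact: act_balanced.
by move=> s p a; rewrite scale_rscale.
Qed.

(** Endomorphisms of the regular module are right multiplications. Under P (x) R = P they become the
    right multiplications on [P], so faithfulness gives injectivity and fullness surjectivity. *)
Lemma invertible_rmul_bijective : bijective (@rmul S R P).
Proof.
apply: inj_surj_bijective => [a b ab|h].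
  suff e : mk_linear (mulr_linear a) = mk_linear (mulr_linear b).
    by have := congr1 (fun f : {linear R^o -> R^o} => f 1) e; rewrite /= !mul1r.
  apply: (equivalence_faithful invP); apply/linear_ext/tensor_ext.
  - by move=> t u; rewrite linearD.
  - by move=> t u; rewrite linearD.
  move=> p c; rewrite /= !tens_map_funE /= -[c * a]mulr1 -[c * b]mulr1.
  rewrite -!tens_bal -!rscaleA; congr tens.
  exact: (congr1 (fun f : EndRing P => f (p *r c)) ab).
pose act : {linear tensor P R^o -> P} := mk_linear act_linear.
pose ins : {linear P -> tensor P R^o} := mk_linear (@tens_linearl S R P R^o 1).
pose k : {linear tensor P R^o -> tensor P R^o} :=
  ins \o ((h : {linear P -> P}) \o act : {linear tensor P R^o -> P}).
have actE p a : act (tens p a) = p *r a by exact/tens_liftE/act_balanced.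
have [f fk] := equivalence_full invP (X := R^o) (Y := R^o) k.
(* [f] is right multiplication by [f 1]; evaluating [fk] at p (x) 1 gives p f(1) = h(p). *)
exists (f 1); apply: linear_ext => p.
pose t : tensor P R^o := tens p (1 : R^o).
have := congr1 (fun g : {linear tensor P R^o -> tensor P R^o} => act (g t)) fk.
rewrite -[LHS]/(act (tens_map P f t)) tens_mapE actE => e.
by rewrite [LHS]e -[LHS]/(act (tens (h (act t)) (1 : R^o))) !actE !rscale1.
Qed.

Lemma invertible_trace : exists u : seq (ldual * P), \sum_(x <- u) x.1 x.2 = 1 :> S.
Proof.
have [M [f [g [_ fg]]]] := equivalence_dense invP (S^o : lmodType S).
have [s sP] := tensor_sum (g 1).
(* Each pure tensor p (x) m of the preimage of 1 contributes the functional f(- (x) m), evaluated at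
   p. *)
exists [seq ((f \o mk_linear (@tens_linearl S R P M x.2) : ldual), x.1) | x <- s].
rewrite big_map; have /= <- := congr1 (fun h : {linear S^o -> S^o} => h 1) fg.
by rewrite sP linear_sum.
Qed.

Lemma invertible_morita : exists kappa, @morita_context S R P kappa.
Proof.
have [kappa kP] := rmul_bijective_pairing invertible_rmul_bijective.
exists kappa; split=> //; first exact: invertible_trace.
have [u uP] := invertible_trace.
have inj := rmul_bijective_inj invertible_rmul_bijective.
pose T (a : R^o) :=
  `[< exists v : seq (ldual * P), a = \sum_(x <- v) kappa x.1 x.2 >].
have kT psi q : T (kappa psi q).
  by apply/asboolP; exists [:: (psi, q)]; rewrite big_seq1.
have subT : GRing.submod_closed (T : {pred R^o}).
  split; first by apply/asboolP; exists [::]; rewrite big_nil.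
  move=> a x y /asboolP[v ->] /asboolP[w ->]; apply/asboolP.
  (* [T] is stable under left multiplication: p a kappa(psi)(q) = psi(p a) q, so a kappa(psi)(q) is
     the value at q for the twisted functional. *)
  pose twist (psi : ldual) : ldual := psi \o rmul_fun a.
  exists ([seq (twist z.1, z.2) | z <- v] ++ w).
  rewrite big_cat big_map /= scaler_sumr; congr (_ + _).
  apply: eq_bigr => z _; apply: inj => p.
  by rewrite -[RHS]kP [LHS](esym (rscaleA _ _ _)) -kP.
suff : 1 - 0 \in T by rewrite subr0 => /asboolP[v ->]; exists v.
apply/(quot_pi_eq subT).
(* The projection onto R/T vanishes, since it does so after tensoring with [P]. *)
have e : quot_pi subT = \0 :> {linear R^o -> quot_mod subT}.
  apply: (equivalence_faithful invP); apply/linear_ext/tensor_ext.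
  - by move=> t t'; rewrite linearD.
  - by move=> t t'; rewrite linearD.
  move=> p a; rewrite /= !tens_map_funE /= tens0r.
  rewrite -[a]mulr1 [quot_pi _ _]linearZ_LR -tens_bal.
  (* Expanding 1 in [S] writes the left factor as sum x_i kappa(psi_i)(p a); each coefficient lies
     in [T] and dies once moved across the tensor sign. *)
  rewrite -[X in tens X _](@scale1r S P) -uP scaler_suml tens_suml big1 // => x _.
  rewrite kP tens_bal -linearZ_LR -[RHS](tens0r (quot_mod subT) x.2).
  congr tens; rewrite -[RHS](linear0 (quot_pi subT)).
  by apply/quot_pi_eq; rewrite subr0 [_ *: _]mulr1; apply: kT.
rewrite linear0.
exact: (congr1 (fun f : {linear R^o -> quot_mod subT} => f 1) e).
Qed.

End InvertibleContext.

Theorem theorem4p9 (R S : pzRingType) (P : bimodType S R) :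
  invertible P <-> projective_rank_one P.
Proof.
split=> [/invertible_morita[kappa]|/rank_one_morita[kappa]].
  exact: morita_rank_one.
exact: morita_invertible.
Qed.
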